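(* Let $q$ be an odd prime power and let $\gamma,\delta\in\mathbb{F}_{q^2}$ with $\gamma\neq 0$. Then the polynomial $$f(x)=(x^q-x+\delta)^{2q}+\gamma x$$ is a permutation polynomial of $\mathbb{F}_{q^2}$ if and only if $\gamma\in\mathbb{F}_q^*$ and $\mathrm{Tr}_q^{q^2}(\delta)+\mathrm{Tr}_q^{q^2}(\gamma)/4\neq 0$.
   Context: A polynomial over a finite field $\mathbb{F}$ is a permutation polynomial of $\mathbb{F}$ if the map it induces on $\mathbb{F}$ is a bijection. For $x\in\mathbb{F}_{q^2}$, $\mathrm{Tr}_q^{q^2}(x)=x+x^q$. *)

(* Defs.v *)
From HB Require Import structures.
From mathcomp Require Import all_boot all_order all_algebra all_field.

Set Implicit Arguments.
Unset Strict Implicit.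
Unset Printing Implicit Defensive.

Import GRing.Theory.
Local Open Scope ring_scope.

Definition prime_power (q : nat) : Prop :=
  exists p k : nat, [/\ prime p, (0 < k)%N & q = (p ^ k)%N].

Definition permutation_poly (F : fieldType) (f : {poly F}) : Prop :=
  bijective (fun x : F => f.[x]).

(* The trace from F_{q^2} to F_q, with its values regarded in F_{q^2}. *)
Definition Tr (F : fieldType) (q : nat) (x : F) : F := x + x ^+ q.

(* Main.v *)
(* Let sigma be the q-power Frobenius, an involution of L with fixed field K.  Then
   f(x) = (x - sigma x + sigma delta)^2 + gamma x.  Put v = (x - y) - sigma (x - y)
   and split f(x) - f(y) along L = ker(sigma - 1) + ker(sigma + 1).  The base point y
   is free to cancel the component in ker(sigma - 1) when v != 0, so f fails to be
   injective exactly when the component in ker(sigma + 1), which does not involve y,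
   vanishes for some v != 0:
   v c + (gamma - sigma gamma) a / 2 = 0 with a in K and c = Tr delta + Tr gamma / 4. *)
Require Import Defs.
From HB Require Import structures.
From mathcomp Require Import all_boot all_order all_algebra all_field.
From mathcomp Require Import ring.

Set Implicit Arguments.
Unset Strict Implicit.
Unset Printing Implicit Defensive.

Import GRing.Theory.
Local Open Scope ring_scope.

Section Involution.

Variables (F : fieldType) (sigma : {rmorphism F -> F}).
Hypotheses (sigmaK : involutive sigma) (two_neq0 : 2%:R != 0 :> F).
Variables gamma delta : F.

Let f (x : F) : F := (x - sigma x + sigma delta) ^+ 2 + gamma * x.
Let c : F := delta + sigma delta + (gamma + sigma gamma) / 4%:R.

Let four_neq0 : 4%:R != 0 :> F.
Proof. by rewrite (natrM _ 2 2) mulf_neq0. Qed.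

(** Applying [sigma] turns the base of the square into [delta - (x - sigma x)], so the difference of
    the two squares is linear in [x - sigma x]. Hence the anti-fixed component of [f x - f y] is v
    times [c], forcing v = 0; the squares then agree and only [gamma * (x - y)] is left. *)
Lemma twisted_square_inj :
  gamma != 0 -> sigma gamma = gamma -> c != 0 -> injective f.
Proof.
move=> gamma0 fix_gamma c0 x y /eqP; rewrite -subr_eq0 => /eqP fxy.
have sfxy : sigma (f x - f y) = 0 by rewrite fxy rmorph0.
have key : (x - y - sigma (x - y)) * c = 0.
  transitivity ((f x - f y - sigma (f x - f y)) / 2%:R); last first.
    by rewrite sfxy fxy subrr mul0r.
  rewrite /c /f !(rmorphD, rmorphB, rmorphN, rmorphM, rmorphXn) /= !sigmaK.
  by rewrite fix_gamma; field; apply/andP.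
move/eqP: key; rewrite mulf_eq0 (negPf c0) orbF subr_eq0 rmorphB => /eqP v0.
have : gamma * (x - y) = 0.
  rewrite -fxy /f.
  have -> : x - sigma x = y - sigma y.
    by apply/eqP; rewrite -subr_eq0; apply/eqP; rewrite -[X in _ = X](subrr (x - y)) {2}v0; ring.
  by ring.
by move/eqP; rewrite mulf_eq0 (negPf gamma0) subr_eq0 => /eqP.
Qed.

(* With w = 2y and u = a + v/2 one has f (u + y) - f y = v (2w + 2 sigma delta + v)
   + gamma u; s is the anti-fixed part of 2w + 2 sigma delta + v that makes the
   fixed component vanish, and the anti-fixed component is the last hypothesis. *)
Lemma twisted_square_collision (a v : F) :
  sigma a = a -> sigma v = - v -> v != 0 ->
  v * c + (gamma - sigma gamma) / 2%:R * a = 0 -> ~ injective f.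
Proof.
move=> fix_a anti_v v0 eq0 inj_f.
pose s := - ((gamma + sigma gamma) / 2%:R * a / v + (gamma - sigma gamma) / 4%:R).
have anti_s : sigma s = - s.
  rewrite /s !(rmorphD, rmorphB, rmorphN, rmorphM, fmorphV, rmorph_nat) /=.
  by rewrite sigmaK fix_a anti_v; field; rewrite oppr_eq0 v0 two_neq0 four_neq0.
pose w := (s - v) / 2%:R - (sigma delta - delta) / 2%:R.
have anti_w : sigma w = - w.
  rewrite /w rmorphB !fmorph_div (rmorphB _ s) (rmorphB _ (sigma delta)) /=.
  by rewrite rmorph_nat sigmaK anti_s anti_v; field.
pose y := w / 2%:R; pose u := a + v / 2%:R.
have sy : sigma y = - y by rewrite /y fmorph_div rmorph_nat anti_w mulNr.
have su : sigma u = a - v / 2%:R.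
  by rewrite /u rmorphD fmorph_div rmorph_nat fix_a anti_v mulNr.
have /inj_f : f (u + y) = f y.
  apply/eqP; rewrite -subr_eq0 -eq0 /f rmorphD su sy /u /y /w /s /c.
  by apply/eqP; field; rewrite ?v0 ?two_neq0 ?four_neq0.
move/(canRL (addrK _)); rewrite subrr => u0.
(* Both [a + v / 2] and its conjugate [a - v / 2] vanish, so v = 0. *)
move: su; rewrite u0 rmorph0 => /eqP; rewrite eq_sym subr_eq0 => /eqP aE.
move/eqP: v0; apply; rewrite -[RHS]u0 /u aE.
by field.
Qed.

Lemma twisted_square_injP :
  (exists t, sigma t != t) -> gamma != 0 ->
  injective f <-> sigma gamma = gamma /\ c != 0.
Proof.
move=> [t st] gamma0; split; last by case; exact: twisted_square_inj.
pose v := t - sigma t.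
have v0 : v != 0 by rewrite subr_eq0 eq_sym.
have anti_v : sigma v = - v by rewrite rmorphB sigmaK opprB.
have sc : sigma c = c.
  rewrite /c !rmorphD fmorph_div rmorphD rmorph_nat /= !sigmaK.
  by rewrite (addrC delta) (addrC gamma).
move=> inj_f; have fix_gamma : sigma gamma = gamma.
  apply/eqP/negPn/negP => gamma_moved.
  have g0 : gamma - sigma gamma != 0 by rewrite subr_eq0 eq_sym.
  (* The collision equation solved for a; this a is fixed because [v] and [gamma - sigma gamma] are
     anti-fixed and [c] is fixed. *)
  apply: (@twisted_square_collision (- (2%:R * v * c / (gamma - sigma gamma))) v) inj_f => //.
    rewrite rmorphN fmorph_div !rmorphM rmorph_nat sc anti_v rmorphB /= sigmaK.
    by rewrite -[sigma gamma - gamma]opprB invrN !mulrN !mulNr opprK.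
  by field; rewrite g0 two_neq0.
split=> //; apply/eqP => c0.
apply: (@twisted_square_collision 0 v) inj_f => //; first exact: rmorph0.
by rewrite c0 !mulr0 addr0.
Qed.

End Involution.

(** This makes the [#|K|]-th power map additive on [L]. *)
Lemma pchar_nat_card (K : finFieldType) (A : lalgType K) : [pchar A].-nat #|K|.
Proof.
have [p pr_p pcharKp] := finPcharP K.
have := card_pprimeChar pcharKp; rewrite -[#|pPrimeCharType _|]/#|K| => ->.
by rewrite pnatX pnatE // pchar_lalg pcharKp.
Qed.

Section FrobeniusAut.

Variables (K : finFieldType) (L : fieldExtType K).

Definition frobenius_card (x : L) : L := x ^+ #|K|.

Lemma frobenius_card_is_zmod_morphism : zmod_morphism frobenius_card.
Proof.
move=> x y; rewrite /frobenius_card exprDn_pchar ?pchar_nat_card //.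
by congr (_ + _); rewrite exprNn_pchar ?pchar_nat_card.
Qed.

Lemma frobenius_card_is_monoid_morphism : monoid_morphism frobenius_card.
Proof. by split=> [|x y]; rewrite /frobenius_card ?expr1n ?exprMn. Qed.

HB.instance Definition _ :=
  GRing.isZmodMorphism.Build L L frobenius_card frobenius_card_is_zmod_morphism.
HB.instance Definition _ :=
  GRing.isMonoidMorphism.Build L L frobenius_card
    frobenius_card_is_monoid_morphism.

Lemma frobenius_card_fixed (x : L) :
  (x \in 1%VS) = (frobenius_card x == x).
Proof. by rewrite (Fermat's_little_theorem 1%AS) dimv1 expn1. Qed.

Lemma frobenius_cardK : \dim {:L} = 2%N -> involutive frobenius_card.
Proof.
move=> dimL x; apply/eqP.
by rewrite /frobenius_card -exprM mulnn -dimL -Fermat's_little_theorem memvf.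
Qed.

Lemma frobenius_card_moves : \dim {:L} = 2%N -> exists t, frobenius_card t != t.
Proof.
move=> dimL; have /subvPn[t _] : ~~ ({:L} <= 1)%VS.
  by apply/negP=> /dimvS; rewrite dimL dimv1.
by rewrite frobenius_card_fixed; exists t.
Qed.

(** In characteristic 2, [#|K|] would be a power of 2, and being odd it would equal 1. *)
Lemma two_neq0_odd_card : odd #|K| -> 2%:R != 0 :> L.
Proof.
move=> oddK; apply/negP=> two0.
have pchar2 : 2 \in [pchar L] by rewrite inE.
move: (pchar_nat_card L); rewrite (eq_pnat _ (pcharf_eq pchar2)) => pnat2.
move: oddK; rewrite odd_2'nat => /(pnat_1 pnat2) cardK1.
by have := finNzRing_gt1 K; rewrite cardK1.
Qed.

(** [finvect_type L] is [L] seen as a finite type, being finite-dimensional over [K]. *)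
Lemma injective_bijective (g : L -> L) : injective g -> bijective g.
Proof. exact: (@injF_bij (finvect_type L)). Qed.

End FrobeniusAut.

(* K is F_q and L is F_{q^2}; the copy of F_q inside L is the line 1%VS. *)
Theorem theorem3p3 (q : nat) (q_pp : prime_power q) (q_odd : odd q)
    (K : finFieldType) (cardK : #|K| = q)
    (L : fieldExtType K) (dimL : \dim {:L} = 2%N)
    (gamma delta : L) (gamma_neq0 : gamma != 0) :
  permutation_poly
    (('X^q - 'X + delta%:P) ^+ (2 * q) + gamma%:P * 'X : {poly L})
  <-> (gamma \in 1%VS /\ gamma != 0) /\
      Tr q delta + Tr q gamma / 4%:R != 0.
Proof.
subst q.
(* Reading the exponent as a q-th power then a square, Frobenius acts on the base and, being an
   involution, swaps [x ^+ #|K|] with x. *)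
have fE : (fun x => (('X^#|K| - 'X + delta%:P) ^+ (2 * #|K|) + gamma%:P * 'X).[x]) =1
    (fun x => (x - frobenius_card x + frobenius_card delta) ^+ 2 + gamma * x).
  move=> x; rewrite !hornerE mulnC exprM -/(frobenius_card _).
  by rewrite rmorphD rmorphB /= -/(frobenius_card x) (frobenius_cardK dimL).
have fixP : gamma \in 1%VS <-> frobenius_card gamma = gamma.
  by rewrite frobenius_card_fixed; split=> /eqP.
have injP := twisted_square_injP (frobenius_cardK dimL)
  (two_neq0_odd_card L q_odd) delta (frobenius_card_moves dimL) gamma_neq0.
split=> [bij_f|].
  by have /injP[/fixP gammaK c0] := eq_inj (bij_inj bij_f) fE.
case=> [[/fixP gammaK _] c0]; apply: (eq_bij _ (fsym fE)).
by apply/injective_bijective/injP.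
Qed.
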